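(* Let $\mathcal X,\mathcal Y,f,L,L_0,\widehat L,V,q$ be as in the context, and suppose the sampling (lower-mass) condition in the context holds. Let $\overline V_N(x)=\max_{j\in[N]}f(x,y_j)$ and $V_N(x)=\max_{j\in[N]}q(x,y_j)$. Then, with probability one with respect to the samples $y_1,y_2,\ldots$, the following holds. Let $\{x_N\}\subseteq\mathcal X$ satisfy $x_N\to x$ as $N\to\infty$. If either $$0\in\partial\overline V_N(x_N)+\mathcal N_{\mathcal X}(x_N)\ \text{ for all } N,\qquad\text{or}\qquad 0\in\partial V_N(x_N)+\mathcal N_{\mathcal X}(x_N)\ \text{ for all } N,$$ then the limit point $x$ satisfies $$0\in\partial V(x)+\mathcal N_{\mathcal X}(x).$$
   Context: $\|\cdot\|$ is the Euclidean norm (operator norm for matrices), $[N]=\{1,\ldots,N\}$. $\mathcal X\subseteq\mathbb R^n$ and $\mathcal Y\subseteq\mathbb R^m$ are nonempty, compact, convex sets. $f$ is a real-valued function, twice continuously differentiable in an open neighborhood of $\mathcal X\times\mathcal Y$, and there are constants $L,L_0>0$ such that for all $(x,y),(x',y')\in\mathcal X\times\mathcal Y$: $\|\nabla f(x,y)-\nabla f(x',y')\|\le L\|(x,y)-(x',y')\|$ and $\|\nabla^2_{xy}f(x,y)-\nabla^2_{xy}f(x',y')\|\le L_0\|(x,y)-(x',y')\|$. Moreover $L$ is chosen large enough that also $\|\nabla f(x,y)\|\le L$ on $\mathcal X\times\mathcal Y$. $\widehat L>L$ is a fixed constant. Define $$V(x)=\max_{y\in\mathcal Y}f(x,y),\qquad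 q(x,y)=f(x,y)+\max_{z\in\mathcal Y}\Big(\langle\nabla_yf(x,y),z-y\rangle-\tfrac{\widehat L}{2}\|z-y\|^2\Big).$$ Sampling (lower-mass) condition: $y_1,y_2,\ldots$ are i.i.d. samples from a probability measure $P$ supported on $\mathcal Y$, $Y_N=\{y_1,\ldots,y_N\}$, and there are constants $C_0,\gamma,\delta_0>0$ with $P(\{y\in\mathcal Y:\|y-y_0\|\le\delta\})\ge C_0\delta^\gamma$ for all $y_0\in\mathcal Y$ and $\delta\in(0,\delta_0)$. $\partial$ denotes the Clarke subdifferential: $\partial h(\bar x)=\{z:\langle z,d\rangle\le\limsup_{x\to\bar x,t\downarrow0}(h(x+td)-h(x))/t\ \forall d\}$; the functions $V,\overline V_N,V_N$ are understood to be defined by the same formulas for $x$ in an open neighborhood of $\mathcal X$. $\mathcal N_{\mathcal X}(x)=\{\xi:\langle\xi,x'-x\rangle\le0\ \forall x'\in\mathcal X\}$. *)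

(* Defs.v *)
From HB Require Import structures.
From mathcomp Require Export all_boot all_order all_algebra finmap.
From mathcomp Require Export all_classical all_reals all_analysis.
Export Order.TTheory GRing.Theory Num.Theory.
Export numFieldNormedType.Exports.

Set Implicit Arguments.
Unset Strict Implicit.
Unset Printing Implicit Defensive.

Local Open Scope classical_set_scope.
Local Open Scope ring_scope.

Section euclidean.
Context {R : realType}.

Definition dotv {k : nat} (u v : 'rV[R]_k) : R := \sum_(i < k) u 0 i * v 0 i.

(* The norm that the library puts on matrices is the maximum norm, which
   induces the same topology. *)
Definition enorm {k : nat} (u : 'rV[R]_k) : R := Num.sqrt (dotv u u).

(* A acts on row vectors; as a matrix and its transpose have the same operator
   norm, this is also the norm of the action on column vectors. *)
Definition opnorm {k l : nat} (A : 'M[R]_(k, l)) : R :=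
  sup [set enorm (u *m A) | u in [set u : 'rV[R]_k | enorm u <= 1]].

End euclidean.

Section calculus.
Context {R : realType} {k : nat}.

Definition grad (f : 'rV[R]_k -> R) (z : 'rV[R]_k) : 'rV[R]_k :=
  \row_(i < k) 'D_(delta_mx 0 i) f z.

(* Entry (i, j) is the derivative of grad_j in the i-th coordinate. *)
Definition hessian (f : 'rV[R]_k -> R) (z : 'rV[R]_k) : 'M[R]_k :=
  'J (grad f) z.

Definition C2_on (U : set 'rV[R]_k) (f : 'rV[R]_k -> R) : Prop :=
  forall z, U z -> [/\ differentiable f z, differentiable (grad f) z &
                       {for z, continuous (hessian f)}].

End calculus.

(* A function of (x, y) is a function on 'rV_(n + m), evaluated at row_mx x y. *)
Section blocks.
Context {R : realType} {n m : nat}.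
Variable f : 'rV[R]_(n + m) -> R.

Definition grad_y (x : 'rV[R]_n) (y : 'rV[R]_m) : 'rV[R]_m :=
  rsubmx (grad f (row_mx x y)).

Definition hess_xy (x : 'rV[R]_n) (y : 'rV[R]_m) : 'M[R]_(n, m) :=
  ursubmx (hessian f (row_mx x y)).

End blocks.

Section nonsmooth.
Context {R : realType} {n : nat}.

(* The limit superior is taken in the extended reals. *)
Definition clarke_dd (h : 'rV[R]_n -> R) (xb d : 'rV[R]_n) : \bar R :=
  limf_esup (fun p : 'rV[R]_n * R => ((h (p.1 + p.2 *: d) - h p.1) / p.2)%:E)
            (filter_prod (nbhs xb) (0 : R)^'+).

Definition clarke_subdiff (h : 'rV[R]_n -> R) (xb : 'rV[R]_n) :
    set 'rV[R]_n :=
  [set z | forall d, ((dotv z d)%:E <= clarke_dd h xb d)%E].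

Definition normal_cone (X : set 'rV[R]_n) (x : 'rV[R]_n) : set 'rV[R]_n :=
  [set xi | forall x', X x' -> dotv xi (x' - x) <= 0].

Definition stationary (X : set 'rV[R]_n) (h : 'rV[R]_n -> R) (x : 'rV[R]_n) :
    Prop :=
  [set g + xi | g in clarke_subdiff h x & xi in normal_cone X x] 0.

End nonsmooth.

(* Maxima are written as suprema: below they are taken over nonempty finite
   sets, or of continuous functions over nonempty compact sets, so they are
   attained. The formulas make sense for every x; at points x in a neighborhood
   of X they only involve f where it is smooth. *)
Section value_functions.
Context {R : realType} {n m : nat}.
Variables (f : 'rV[R]_(n + m) -> R) (Y : set 'rV[R]_m).

Definition Vmax (x : 'rV[R]_n) : R := sup [set f (row_mx x y) | y in Y].

Definition qfun (Lhat : R) (x : 'rV[R]_n) (y : 'rV[R]_m) : R :=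
  f (row_mx x y) +
  sup [set dotv (grad_y f x y) (z - y) - Lhat / 2 * enorm (z - y) ^+ 2
       | z in Y].

(* Samples are numbered from 0: the first N of them are ys 0, ..., ys N.-1. *)
Definition Vbar (ys : nat -> 'rV[R]_m) (N : nat) (x : 'rV[R]_n) : R :=
  sup [set f (row_mx x (ys j)) | j in [set j | (j < N)%N]].

Definition Vq (Lhat : R) (ys : nat -> 'rV[R]_m) (N : nat) (x : 'rV[R]_n) : R :=
  sup [set qfun Lhat x (ys j) | j in [set j | (j < N)%N]].

End value_functions.

(* The library has no sigma-algebra on row vectors; this is the Borel one. *)
Definition rVborel (R : realType) (m : nat) :=
  g_sigma_algebraType (@open 'rV[R]_m).

Section sampling.
Context {R : realType} {d d' : measure_display}.
Context {Omega : measurableType d} {T : measurableType d'}.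
Variable Pr : probability Omega R.

Definition mutually_independent (y : nat -> {RV Pr >-> T}) : Prop :=
  forall (J : {fset nat}) (A : nat -> set T), (forall j, measurable (A j)) ->
  Pr (\bigcap_(j in [set` J]) (y j @^-1` A j)) =
  (\prod_(j <- J) Pr (y j @^-1` A j))%E.

Definition iid_samples (P : probability T R) (y : nat -> {RV Pr >-> T}) :
    Prop :=
  mutually_independent y /\
  forall j (A : set T), measurable A -> distribution Pr (y j) A = P A.

End sampling.

(* Main.v *)
Require Import Defs.
From mathcomp Require Import ring lra.

Set Implicit Arguments.
Unset Strict Implicit.
Unset Printing Implicit Defensive.
Local Open Scope classical_set_scope.
Local Open Scope ring_scope.

(* Let [g N] be a Clarke subgradient of the sampled value function at [x_ N]
   with [- g N] normal to [X]. The difference quotients which witness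
   [dotv (g N) d <= clarke_dd _ (x_ N) d] are, up to a vanishing error, bounded
   by those of the objective at a nearly maximal parameter [w_ N], and by the
   mean value theorem these are derivatives of the objective near [x_ N]. All
   limits are taken along one ultrafilter, so that the [w_ N] converge by
   compactness to some [w], which is a maximizer because the samples are dense
   in [Y]. Danskin's lower bound turns the derivative at [w] into a lower bound
   of the Clarke derivative of [Vmax]. For [Vq] the parameter is a pair
   [(y, z)], and the descent lemma together with [L < Lhat] forces [y = z] in
   the limit, where the penalty term and its derivative vanish. The samples are
   almost surely dense because each of countably many balls that cover [Y] at
   all scales has positive mass, hence is missed by the first [M] samples with
   a probability that decays geometrically in [M]. *)

(** An ultrafilter converges to each of its cluster points: it contains the preimage of a
    neighborhood or of its complement, and clustering excludes the latter. This replaces the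
    extraction of subsequences. *)
Lemma cvg_ultra_compact (I : Type) (T : topologicalType) (K : set T)
    (F : set_system I) (FU : UltraFilter F) (u : I -> T) :
  compact K -> F (u @^-1` K) -> exists2 w, K w & u @ F --> w.
Proof.
move=> cK FK; have [w [Kw clw]] := cK (u @ F) _ FK.
exists w => // W nW.
have [//|FnW] := in_ultra_setVsetC (u @^-1` W) FU.
by have [z []] := clw (~` W) W FnW nW.
Qed.

(** * Clarke derivatives of suprema *)

Section lines.
Context {R : realType} {V : normedModType R}.

Lemma is_derive_line (f : V -> R) (z d : V) (s l : R) :
  is_derive (z + s *: d) d f l -> is_derive s 1 (fun r => f (z + r *: d)) l.
Proof.
have e : (fun h : R => h^-1 *: (((fun r => f (z + r *: d)) \o shift s) (h *: 1)
      - f (z + s *: d))) =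
    (fun h : R => h^-1 *: ((f \o shift (z + s *: d)) (h *: d) -
      f (z + s *: d))).
  apply/funext => h /=; congr (_ *: (f _ - _)).
  by rewrite [h *: 1]mulr1 scalerDl addrCA.
by move=> [df <-]; split; [rewrite /derivable e|rewrite /derive e].
Qed.

Lemma mean_value_line (f df : V -> R) (z d : V) (t : R) : 0 < t ->
  (forall s, 0 <= s <= t -> is_derive (z + s *: d) d f (df (z + s *: d))) ->
  exists2 s, 0 <= s <= t & f (z + t *: d) - f z = t * df (z + s *: d).
Proof.
move=> t0 H.
have H1 s : 0 <= s <= t ->
    is_derive s 1 (fun r => f (z + r *: d)) (df (z + s *: d)).
  by move=> st; apply: is_derive_line; exact: H.
have [c|c|c] :=
  @MVT R (fun r => f (z + r *: d)) (fun r => df (z + r *: d)) 0 t t0.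
- by rewrite in_itv/= => /andP[c0 ct]; apply: H1; rewrite !ltW.
- apply: continuous_in_subspaceT => r; rewrite inE/= in_itv/= => rt.
  by apply/differentiable_continuous/derivable1_diffP; have [] := H1 r rt.
- rewrite in_itv/= => /andP[c0 ct]; rewrite scale0r addr0 subr0 => ->.
  by exists c; [rewrite !ltW|rewrite mulrC].
Qed.

End lines.

(** The limit superior is an infimum of suprema over the sets of the filter, and [ball x r] times
    the interval from [0] to [r] is one of these sets. *)
Lemma clarke_dd_gt {R : realType} {n : nat} (h : 'rV[R]_n -> R)
    (x d : 'rV[R]_n) (a b r : R) :
  (a%:E <= clarke_dd h x d)%E -> b < a -> 0 < r ->
  exists z t, [/\ ball x r z, 0 < t, t < r & b < (h (z + t *: d) - h z) / t].
Proof.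
move=> ha ba r0.
pose A := ball x r `*` [set t : R | 0 < t < r].
have FA : filter_prod (nbhs x) (0 : R)^'+ A.
  exists (ball x r, [set t : R | 0 < t < r]) => //=; split.
    exact: nbhsx_ballx.
  near=> t; apply/andP; split; near: t; [exact: nbhs_right_gt|].
  exact: nbhs_right_lt.
have hA : (b%:E < ereal_sup ((fun p : 'rV[R]_n * R =>
     ((h (p.1 + p.2 *: d) - h p.1) / p.2)%:E) @` A))%E.
  apply: (@lt_le_trans _ _ a%:E); first by rewrite lte_fin.
  apply: le_trans ha _; apply: ereal_inf_lbound; exists A => //.
have /ereal_sup_gt[_ [[z t] [/= xz /andP[t0 tr] <-]]] := hA.
by rewrite lte_fin => hb; exists z, t.
Unshelve. all: by end_near. Qed.

(* [phi] plays the role of a parametrized objective, [dphi] of its derivative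
   in the direction [d], and [h N] of its supremum over the parameters in
   [S N]. The difference quotients which nearly attain the Clarke derivative of
   [h N] are bounded by those of [phi] at a nearly maximal parameter; the limit
   parameters of the latter are maximizers. *)
Lemma clarke_dd_sup_limit {R : realType} {n : nat} {T : topologicalType}
    (K : set T) (phi dphi : 'rV[R]_n -> T -> R) (x d : 'rV[R]_n)
    (F : set_system nat) (S : nat -> set T) (h : nat -> 'rV[R]_n -> R)
    (x_ : nat -> 'rV[R]_n) (g : nat -> R) :
  UltraFilter F -> \oo `<=` F -> compact K ->
  (forall w, K w -> (fun p => phi p.1 p.2) @ (x, w) --> phi x w) ->
  (forall w, K w -> (fun p => dphi p.1 p.2) @ (x, w) --> dphi x w) ->
  (forall w, K w ->
     \forall p \near (x, w), is_derive p.1 d (phi^~ p.2) (dphi p.1 p.2)) ->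
  (forall N, (0 < N)%N -> S N `<=` K) ->
  (forall N z s, (0 < N)%N -> S N s -> phi z s <= h N z) ->
  (forall N z (e : R), (0 < N)%N -> 0 < e ->
     exists2 s, S N s & h N z - e < phi z s) ->
  x_ @ F --> x ->
  (forall N, (0 < N)%N -> ((g N)%:E <= clarke_dd (h N) (x_ N) d)%E) ->
  exists w, [/\ K w,
    forall s, K s -> F [set N | S N s] -> phi x s <= phi x w &
    forall e : R, 0 < e -> F [set N | g N <= dphi x w + e]].
Proof.
move=> FU FN cK cphi cdphi dphiP SK hub happ x_x hg.
have FF : Filter F by apply: @filter_filter; exact: ultra_proper.
(* This one tolerance bounds the distance to [x_ N], the step length and the loss in the Clarke
   derivative. The gap to the supremum is [t * e_ N], so that it still vanishes after division by
   [t]. *)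
pose e_ N : R := N.+1%:R^-1.
have e_gt0 N : 0 < e_ N by rewrite invr_gt0.
have e_0 : e_ @ F --> 0.
  apply: cvg_trans; last exact: (@cvg_harmonic R).
  by apply: cvg_app.
have step N : exists zts : 'rV[R]_n * R * T, (0 < N)%N ->
    [/\ ball (x_ N) (e_ N) zts.1.1, 0 < zts.1.2 < e_ N, S N zts.2,
     h N (zts.1.1 + zts.1.2 *: d) - zts.1.2 * e_ N <
       phi (zts.1.1 + zts.1.2 *: d) zts.2 &
     g N - e_ N < (h N (zts.1.1 + zts.1.2 *: d) - h N zts.1.1) / zts.1.2].
  (* At [N = 0] nothing is claimed, and [happ] at [1] merely supplies an inhabitant of [T]. *)
  have [N0|] := ltnP 0 N; last first.
    rewrite leqn0 => /eqP->.
    have [s _ _] := happ 1%N 0 1 isT ltr01.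
    by exists (0, 0, s).
  have gN : g N - e_ N < g N by rewrite ltrBlDr ltrDl.
  have [z [t [xz t0 te hzt]]] := clarke_dd_gt (hg N N0) gN (e_gt0 N).
  have te0 : 0 < t * e_ N by rewrite mulr_gt0.
  have [s Ss hs] := happ N (z + t *: d) _ N0 te0.
  by exists (z, t, s); split => //=; rewrite t0 te.
have {step} [zts ztsP] := choice step.
pose z_ N := (zts N).1.1; pose t_ N := (zts N).1.2; pose w_ N := (zts N).2.
have Fpos : F [set N | (0 < N)%N] by apply: FN; exists 1%N.
have Fw : F (w_ @^-1` K).
  by apply: filterS Fpos => N N0; apply: (SK N N0); have [] := ztsP N N0.
have [w Kw w_w] := cvg_ultra_compact FU cK Fw.
have t_0 : t_ @ F --> 0.
  apply: (@squeeze_cvgr _ _ _ _ (fun=> 0) e_); [|exact: cvg_cst|exact: e_0].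
  apply: filterS Fpos => N N0; have [_ /andP[t0 te] _ _ _] := ztsP N N0.
  by rewrite !ltW.
have z_x : z_ @ F --> x.
  apply/cvgrPdist_lt => e e0; near=> N.
  rewrite (_ : x - z_ N = (x - x_ N) + (x_ N - z_ N)); last first.
    by rewrite addrA subrK.
  rewrite (splitr e) (le_lt_trans (ler_normD _ _))// ltrD//.
    near: N; move/cvgrPdist_lt : x_x; apply; by rewrite divr_gt0.
  have N0 : (0 < N)%N by near: N.
  have [+ _ _ _ _] := ztsP N N0.
  rewrite -ball_normE/= => /lt_trans; apply.
  near: N. move/cvgrPdist_lt : e_0 => /(_ (e / 2)).
  rewrite divr_gt0// => /(_ isT); apply: filterS => N.
  by rewrite sub0r normrN gtr0_norm.
have zt_x : (fun N => z_ N + t_ N *: d) @ F --> x.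
  rewrite -[X in _ --> X]addr0 -(scale0r d).
  by apply: cvgD => //; apply: cvgZr_tmp.
have phi_w : (fun N => phi (z_ N + t_ N *: d) (w_ N)) @ F --> phi x w.
  apply: (@cvg_comp _ _ _ (fun N => (z_ N + t_ N *: d, w_ N))
    (fun p => phi p.1 p.2) F (nbhs (x, w))); last exact: cphi.
  exact: (cvg_pair zt_x w_w).
exists w; split => //.
(* Whenever [s] is in [S N], its value at the shifted point is at most the supremum there, which
   [w_ N] attains up to [t_ N * e_ N]. The claim follows in the limit. *)
- move=> s Ks FS.
  have phi_s : (fun N => phi (z_ N + t_ N *: d) s - t_ N * e_ N) @ F -->
      phi x s - 0 * 0.
    apply: cvgD; last by apply: cvgN; apply: cvgM.
    apply: (@cvg_comp _ _ _ (fun N => (z_ N + t_ N *: d, s))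
      (fun p => phi p.1 p.2) F (nbhs (x, s))); last exact: cphi.
    exact: (cvg_pair zt_x (cvg_cst s)).
  rewrite mul0r subr0 in phi_s.
  apply: (ler_cvg_to phi_s phi_w); near=> N.
  have N0 : (0 < N)%N by near: N.
  have SNs : S N s by near: N.
  have [_ _ _ h2 _] := ztsP N N0.
  apply: ltW; apply: le_lt_trans h2; rewrite lerD2r; exact: hub.
- move=> e e0.
  have e20 : 0 < e / 2 by rewrite divr_gt0.
  (* On [A] times [B] the derivative exists and exceeds its limit by less than [e / 2]. The whole
     segment from [z_ N] to [z_ N + t_ N *: d] must lie in [A] for the mean value theorem. *)
  have [[A B] /= [nA nB] AB] : nbhs (x, w) [set p |
      is_derive p.1 d (phi^~ p.2) (dphi p.1 p.2) /\
      dphi p.1 p.2 < dphi x w + e / 2].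
    apply: filterI; first exact: dphiP.
    have := cdphi w Kw; move/cvgrPdist_lt => /(_ _ e20); apply: filterS => p.
    by rewrite ltr_distlC => /andP[].
  have [r/= r0 rA] := (nbhs_ballP _ _).1 nA.
  have r20 : 0 < r / 2 by rewrite divr_gt0.
  have td0 : (fun N => t_ N * `|d|) @ F --> 0 * `|d|.
    by apply: cvgM => //; exact: cvg_cst.
  rewrite mul0r in td0.
  near=> N.
  have N0 : (0 < N)%N by near: N.
  have [_ /andP[t0 te] SNw h2 h3] := ztsP N N0.
  rewrite -/(t_ N) -/(z_ N) -/(w_ N) in t0 te SNw h2 h3.
  have Bw : B (w_ N) by near: N; exact: w_w.
  have seg s : 0 <= s <= t_ N -> A (z_ N + s *: d).
    move=> /andP[s0 st]; apply: rA; rewrite -ball_normE/=.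
    rewrite opprD addrA (splitr r) (le_lt_trans (ler_normB _ _))// ltrD//.
      by near: N; move/cvgrPdist_lt : z_x; apply.
    rewrite normrZ ger0_norm// (@le_lt_trans _ _ (t_ N * `|d|)) ?ler_wpM2r//.
    near: N; move/cvgrPdist_lt : td0 => /(_ _ r20); apply: filterS => N.
    by rewrite sub0r normrN => /(le_lt_trans (ler_norm _)).
  have [s st E] : exists2 s, 0 <= s <= t_ N &
      phi (z_ N + t_ N *: d) (w_ N) - phi (z_ N) (w_ N) =
      t_ N * dphi (z_ N + s *: d) (w_ N).
    apply: (@mean_value_line R _ (phi^~ (w_ N)) (dphi^~ (w_ N))) => // s st.
    by have [] := AB (z_ N + s *: d, w_ N) (conj (seg s st) Bw).
  have [_/= D] := AB (z_ N + s *: d, w_ N) (conj (seg s st) Bw).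
  have hz := hub N (z_ N) (w_ N) N0 SNw.
  (* The error [e_ N] enters twice, through the Clarke derivative and through the near maximality of
     [w_ N]; together this costs at most the remaining [e / 2]. *)
  have eN : e_ N < e / 4.
    near: N; move/cvgrPdist_lt : e_0 => /(_ (e / 4)).
    rewrite divr_gt0// => /(_ isT); apply: filterS => N.
    by rewrite sub0r normrN gtr0_norm.
  rewrite ltr_pdivlMr// in h3.
  have : (g N - e_ N) * t_ N <
      t_ N * e_ N + t_ N * dphi (z_ N + s *: d) (w_ N) by lra.
  rewrite -mulrDr mulrC ltr_pM2l// => D1.
  lra.
Unshelve. all: by end_near. Qed.

(** * Entrywise limits, the Euclidean norm and limits of stationary points *)

Section matrix_limits.
Context {R : realType} {I : Type} {F : set_system I} {FF : Filter F}.

Lemma cvg_mxP {k l : nat} (u : I -> 'M[R]_(k, l)) (A : 'M[R]_(k, l)) :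
  u @ F --> A <-> forall i j, (fun t => u t i j) @ F --> A i j.
Proof.
split=> [uA i j|H B [P nP PB]].
  exact: (cvg_comp _ _ uA (@coord_continuous R k l i j A)).
have : \forall t \near F, forall i j, P i j (u t i j).
  by apply: filter_forall => i; apply: filter_forall => j; apply: H; exact: nP.
by apply: filterS => t Pt; exact: PB.
Qed.

Lemma cvg_row_mx {k l : nat} (u : I -> 'rV[R]_k) (v : I -> 'rV[R]_l)
    (a : 'rV[R]_k) (b : 'rV[R]_l) :
  u @ F --> a -> v @ F --> b ->
  (fun t => row_mx (u t) (v t)) @ F --> row_mx a b.
Proof.
move=> /cvg_mxP ua /cvg_mxP vb; apply/cvg_mxP => i j; rewrite !mxE.
under eq_fun do rewrite mxE.
by case: (fintype.split j) => c; [exact: ua|exact: vb].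
Qed.

Lemma cvg_rsubmx {k l : nat} (u : I -> 'rV[R]_(k + l))
    (a : 'rV[R]_(k + l)) :
  u @ F --> a -> (fun t => rsubmx (u t)) @ F --> rsubmx a.
Proof.
move=> /cvg_mxP ua; apply/cvg_mxP => i j; rewrite !mxE.
under eq_fun do rewrite mxE.
exact: ua.
Qed.

Lemma cvg_bigsum (J : finType) (u : J -> I -> R) (a : J -> R) :
  (forall j, u j @ F --> a j) ->
  (fun t => \sum_j u j t) @ F --> \sum_j a j.
Proof.
move=> ua; apply: cvg_big => //; exact: add_continuous.
Qed.

Lemma cvg_mulmx {k l p : nat} (u : I -> 'M[R]_(k, l))
    (v : I -> 'M[R]_(l, p)) (a : 'M[R]_(k, l)) (b : 'M[R]_(l, p)) :
  u @ F --> a -> v @ F --> b -> (fun t => u t *m v t) @ F --> a *m b.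
Proof.
move=> /cvg_mxP ua /cvg_mxP vb; apply/cvg_mxP => i j; rewrite !mxE.
under eq_fun do rewrite mxE.
by apply: cvg_bigsum => c; apply: cvgM.
Qed.

Lemma cvg_dotv {k : nat} (u v : I -> 'rV[R]_k) (a b : 'rV[R]_k) :
  u @ F --> a -> v @ F --> b -> (fun t => dotv (u t) (v t)) @ F --> dotv a b.
Proof.
move=> /cvg_mxP ua /cvg_mxP vb; apply: cvg_bigsum => i; exact: cvgM.
Qed.

End matrix_limits.

Section euclidean_lemmas.
Context {R : realType} {k : nat}.
Implicit Types u v w : 'rV[R]_k.

Lemma dotvC u v : dotv u v = dotv v u.
Proof. by apply: eq_bigr => i _; rewrite mulrC. Qed.

Lemma dotvDl u v w : dotv (u + v) w = dotv u w + dotv v w.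
Proof.
by rewrite /dotv -big_split; apply: eq_bigr => i _; rewrite mxE mulrDl.
Qed.

Lemma dotvNl u w : dotv (- u) w = - dotv u w.
Proof. by rewrite /dotv -sumrN; apply: eq_bigr => i _; rewrite mxE mulNr. Qed.

Lemma dotvZl c u w : dotv (c *: u) w = c * dotv u w.
Proof.
by rewrite /dotv mulr_sumr; apply: eq_bigr => i _; rewrite mxE mulrA.
Qed.

Lemma dotvDr u v w : dotv w (u + v) = dotv w u + dotv w v.
Proof. by rewrite dotvC dotvDl !(dotvC w). Qed.

Lemma dotvNr u w : dotv w (- u) = - dotv w u.
Proof. by rewrite dotvC dotvNl dotvC. Qed.

Lemma dotvZr c u w : dotv w (c *: u) = c * dotv w u.
Proof. by rewrite dotvC dotvZl dotvC. Qed.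

Lemma dotv0 u : dotv u 0 = 0.
Proof. by rewrite -(scale0r u) dotvZr mul0r. Qed.

Lemma dotv_delta u i : dotv u (delta_mx 0 i) = u 0 i.
Proof.
rewrite /dotv (bigD1 i)//= big1 ?addr0; first by rewrite mxE !eqxx mulr1.
by move=> j ji; rewrite mxE (negbTE ji) andbF mulr0.
Qed.

Lemma dotv_ge0 u : 0 <= dotv u u.
Proof. by apply: sumr_ge0 => i _; rewrite -expr2 sqr_ge0. Qed.

Lemma enorm_ge0 u : 0 <= enorm u.
Proof. exact: sqrtr_ge0. Qed.

Lemma sqr_enorm u : enorm u ^+ 2 = dotv u u.
Proof. by rewrite sqr_sqrtr// dotv_ge0. Qed.

Lemma enorm0 : enorm (0 : 'rV[R]_k) = 0.
Proof. by rewrite /enorm dotv0 sqrtr0. Qed.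

Lemma coord_le_enorm u i : `|u 0 i| <= enorm u.
Proof.
rewrite -sqrtr_sqr ler_wsqrtr// /dotv (bigD1 i)//= -expr2 lerDl.
by apply: sumr_ge0 => j _; rewrite -expr2 sqr_ge0.
Qed.

Lemma enorm_eq0 u : enorm u = 0 -> u = 0.
Proof.
move=> u0; apply/rowP => i; rewrite mxE; apply/eqP.
by rewrite -normr_le0 -u0 coord_le_enorm.
Qed.

Lemma enormZ c u : enorm (c *: u) = `|c| * enorm u.
Proof.
by rewrite /enorm dotvZl dotvZr mulrA -expr2 sqrtrM ?sqr_ge0// sqrtr_sqr.
Qed.

(** Cauchy-Schwarz, by expanding the square of [enorm v *: u - enorm u *: v], which is nonnegative
    and has the factor [enorm u * enorm v - dotv u v]. *)
Lemma dotv_le_enorm u v : dotv u v <= enorm u * enorm v.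
Proof.
have [u0|u0] := eqVneq (enorm u) 0.
  by rewrite u0 mul0r (enorm_eq0 u0) dotvC dotv0.
have [v0|v0] := eqVneq (enorm v) 0.
  by rewrite v0 mulr0 (enorm_eq0 v0) dotv0.
have {}u0 : 0 < enorm u by rewrite lt_def u0 enorm_ge0.
have {}v0 : 0 < enorm v by rewrite lt_def v0 enorm_ge0.
have := dotv_ge0 (enorm v *: u - enorm u *: v).
rewrite !(dotvDl, dotvDr, dotvNl, dotvNr, dotvZl, dotvZr) (dotvC v u).
rewrite -!sqr_enorm.
have uv := mulr_gt0 u0 v0.
move: (dotv u v) => t.
rewrite (_ : _ + _ = 2 * (enorm u * enorm v) * (enorm u * enorm v - t));
  last by ring.
by rewrite pmulr_rge0 ?subr_ge0// mulr_gt0.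
Qed.

(** This passes from the Euclidean balls of the sampling condition to neighborhoods, which are
    described by the maximum norm. *)
Lemma norm_le_enorm u : `|u| <= enorm u.
Proof.
rewrite [leLHS]mx_normrE; apply: bigmax_le => [|[i j] _ /=].
  exact: enorm_ge0.
by rewrite (ord1 i) coord_le_enorm.
Qed.

End euclidean_lemmas.

Lemma cvg_enorm {R : realType} {I : Type} {F : set_system I} {FF : Filter F}
    {k : nat} (u : I -> 'rV[R]_k) (a : 'rV[R]_k) :
  u @ F --> a -> (fun t => enorm (u t)) @ F --> enorm a.
Proof.
move=> ua; exact: (cvg_comp _ _ (cvg_dotv ua ua) (@sqrt_continuous R _)).
Qed.

Lemma cvg_quadratic_model {R : realType} {I : Type} {F : set_system I}
    {FF : Filter F} {k : nat} (c : R) (u v : I -> 'rV[R]_k) (a b : 'rV[R]_k) :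
  u @ F --> a -> v @ F --> b ->
  (fun t => dotv (u t) (v t) - c * enorm (v t) ^+ 2) @ F -->
  dotv a b - c * enorm b ^+ 2.
Proof.
move=> ua vb; apply: cvgB; first exact: cvg_dotv.
apply: cvgM; first exact: cvg_cst.
under eq_fun do rewrite sqr_enorm.
by rewrite sqr_enorm; exact: cvg_dotv.
Qed.

(* The hypothesis on [h] and [V] is an outer semicontinuity of Clarke
   directional derivatives; for [d] a signed basis vector it also makes the
   subgradients of [h N] at [x_ N] bounded along [F]. *)
Lemma stationary_limit {R : realType} {n : nat} (X : set 'rV[R]_n)
    (F : set_system nat) (h : nat -> 'rV[R]_n -> R) (V : 'rV[R]_n -> R)
    (x_ : nat -> 'rV[R]_n) (x : 'rV[R]_n) :
  UltraFilter F -> \oo `<=` F -> x_ @ F --> x ->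
  (forall N, (0 < N)%N -> stationary X (h N) (x_ N)) ->
  (forall (d : 'rV[R]_n) (g : nat -> R),
    (forall N, (0 < N)%N -> ((g N)%:E <= clarke_dd (h N) (x_ N) d)%E) ->
    exists2 b, (b%:E <= clarke_dd V x d)%E &
      forall e : R, 0 < e -> F [set N | g N <= b + e]) ->
  stationary X V x.
Proof.
move=> FU FN x_x st semi.
have FF : Filter F by apply: @filter_filter; exact: ultra_proper.
have Fpos : F [set N | (0 < N)%N] by apply: FN; exists 1%N.
have step N : exists g : 'rV[R]_n, (0 < N)%N ->
    clarke_subdiff (h N) (x_ N) g /\ normal_cone X (x_ N) (- g).
  have [N0|] := ltnP 0 N; last by exists 0.
  have [g hg [xi hxi E]] := st N N0; exists g => _; split => //.
  rewrite (_ : - g = xi)//; apply/eqP.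
  by rewrite eq_sym -addr_eq0 addrC; apply/eqP.
have {step} [g_ gP] := choice step.
have bd (d : 'rV[R]_n) : exists2 b, (b%:E <= clarke_dd V x d)%E &
      forall e : R, 0 < e -> F [set N | dotv (g_ N) d <= b + e].
  by apply: semi => N N0; have [+ _] := gP N N0; apply.
(* The bounds in the directions of the [i]-th basis vector and its opposite, with tolerance [1],
   confine the coordinate to a compact segment. *)
have coord i : exists c : R, (fun N => g_ N 0 i) @ F --> c.
  have [b1 _ /(_ 1 ltr01) h1] := bd (delta_mx 0 i).
  have [b2 _ /(_ 1 ltr01) h2] := bd (- delta_mx 0 i).
  have [|c _ hc] := @cvg_ultra_compact _ _ `[- (b2 + 1), b1 + 1]%classic F FU
      (fun N => g_ N 0 i) (@segment_compact _ _ _).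
    apply: filterS2 h1 h2 => N /=; rewrite dotvNr dotv_delta in_itv/= => -> h2.
    by rewrite andbT lerNl.
  by exists c.
have {coord} [c cP] := choice coord.
pose g : 'rV[R]_n := \row_i c i.
have g_g : g_ @ F --> g.
  by apply/cvg_mxP => i j; rewrite (ord1 i) mxE; exact: cP.
exists g.
  move=> d; have [b + hb] := bd d; apply: le_trans; rewrite lee_fin.
  apply/ler_addgt0Pr => e e0.
  by apply: (cvgr_to_le (cvg_dotv g_g (cvg_cst d))); exact: hb.
exists (- g); last by rewrite subrr.
(* The normal cone has a closed graph: for fixed [x'] both arguments of the pairing converge. *)
move=> x' Xx'.
have l : (fun N => dotv (- g_ N) (x' - x_ N)) @ F --> dotv (- g) (x' - x).
  by apply: cvg_dotv; [apply: cvgN|apply: cvgB => //; exact: cvg_cst].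
apply: (cvgr_to_le l); apply: filterS Fpos => N N0.
by have [_] := gP N N0; exact.
Qed.

(** * Smooth objectives and the descent lemma *)

Section row_blocks.
Context {R : realType} {n m : nat}.

Lemma dotv_row_mx (a c : 'rV[R]_n) (b e : 'rV[R]_m) :
  dotv (row_mx a b) (row_mx c e) = dotv a c + dotv b e.
Proof.
rewrite /dotv big_split_ord /=; congr (_ + _); apply: eq_bigr => i _.
  by rewrite !row_mxEl.
by rewrite !row_mxEr.
Qed.

Lemma dotv_row0mx (p : 'rV[R]_(n + m)) (w : 'rV[R]_m) :
  dotv p (row_mx 0 w) = dotv (rsubmx p) w.
Proof. by rewrite -[p in LHS]hsubmxK dotv_row_mx dotv0 add0r. Qed.

Lemma enorm_row0mx (w : 'rV[R]_m) :
  enorm (row_mx (0 : 'rV[R]_n) w) = enorm w.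
Proof. by rewrite /enorm dotv_row_mx dotv0 add0r. Qed.

Lemma row_mx_line (x d : 'rV[R]_n) (y e : 'rV[R]_m) (t : R) :
  row_mx (x + t *: d) (y + t *: e) = row_mx x y + t *: row_mx d e.
Proof. by rewrite scale_row_mx add_row_mx. Qed.

Lemma is_derive_row_mxl (W : normedModType R) (g : 'rV[R]_(n + m) -> W)
    (x d : 'rV[R]_n) (y : 'rV[R]_m) (l : W) :
  is_derive (row_mx x y) (row_mx d 0) g l ->
  is_derive x d (fun x' => g (row_mx x' y)) l.
Proof.
have e : (fun h : R => h^-1 *: (((fun x' => g (row_mx x' y)) \o shift x)
      (h *: d) - g (row_mx x y))) =
    (fun h : R => h^-1 *: ((g \o shift (row_mx x y)) (h *: row_mx d 0) -
      g (row_mx x y))).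
  by apply/funext => h /=; rewrite scale_row_mx scaler0 add_row_mx add0r.
by move=> [df <-]; split; [rewrite /derivable e|rewrite /derive e].
Qed.

End row_blocks.

Lemma derive_grad {R : realType} {k : nat} (f : 'rV[R]_k -> R)
    (p v : 'rV[R]_k) :
  differentiable f p -> 'D_v f p = dotv (grad f p) v.
Proof.
move=> df; rewrite deriveE// [v in LHS]row_sum_delta linear_sum/=.
apply: eq_bigr => i _; rewrite linearZ/= mulrC; congr (_ * _).
by rewrite mxE deriveE.
Qed.

Lemma is_derive_grad {R : realType} {k : nat} (f : 'rV[R]_k -> R)
    (p v : 'rV[R]_k) :
  differentiable f p -> is_derive p v f (dotv (grad f p) v).
Proof.
by move=> df; rewrite -derive_grad//; exact/derivableP/diff_derivable.
Qed.

(** Pairing the last block with [w] is linear and continuous, so it commutes with the difference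
    quotient of [grad f], whose limit is [v *m hessian f p]. *)
Lemma is_derive_grad_y {R : realType} {n m : nat} (f : 'rV[R]_(n + m) -> R)
    (p v : 'rV[R]_(n + m)) (w : 'rV[R]_m) :
  differentiable (grad f) p ->
  is_derive p v (fun q => dotv (rsubmx (grad f q)) w)
    (dotv (rsubmx (v *m hessian f p)) w).
Proof.
move=> dg; have dgv := @diff_derivable _ _ _ (grad f) p v dg.
have l : (fun h : R => h^-1 *: (((fun q => dotv (rsubmx (grad f q)) w) \o
      shift p) (h *: v) - dotv (rsubmx (grad f p)) w)) @ 0^' -->
    dotv (rsubmx (v *m hessian f p)) w.
  rewrite /hessian -deriveEjacobian//.
  rewrite (_ : (fun _ => _) = (fun h : R => dotv (rsubmx
    (h^-1 *: ((grad f \o shift p) (h *: v) - grad f p))) w)); last first.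
    apply/funext => h /=; rewrite -[LHS]/(_ * _) -dotvNl -dotvDl -dotvZl.
    by congr dotv; apply/rowP => i; rewrite !mxE.
  by apply: cvg_dotv; [apply: cvg_rsubmx; exact: dgv|exact: cvg_cst].
split; last exact: cvg_lim.
by apply/cvg_ex; exists (dotv (rsubmx (v *m hessian f p)) w).
Qed.

Section clarke_lower_bound.
Context {R : realType} {n : nat}.

(** Every set of the product filter contains [(x, t)] for all small [t > 0], so the quotients based
    at [x] itself bound each supremum from below. *)
Lemma clarke_dd_ge (h : 'rV[R]_n -> R) (x d : 'rV[R]_n) (b : R) :
  (\forall t \near (0 : R)^'+, b <= (h (x + t *: d) - h x) / t) ->
  (b%:E <= clarke_dd h x d)%E.
Proof.
move=> hb; apply: le_ereal_inf_tmp => _ [A [[P Q] /= [nP nQ] PQ] <-].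
have [t [Qt ht]] := filter_ex (filterI nQ hb).
apply: (@le_trans _ _ ((h (x + t *: d) - h x) / t)%:E).
  by rewrite lee_fin.
apply: ereal_sup_ubound; exists (x, t) => //; apply: PQ; split => //=.
exact: nbhs_singleton.
Qed.

(* [phi] is a smooth minorant of [h] that touches [h] at [x]. *)
Lemma clarke_dd_ge_derive (h phi : 'rV[R]_n -> R) (x d : 'rV[R]_n) (l : R) :
  is_derive x d phi l -> h x = phi x ->
  (\forall z \near x, phi z <= h z) -> (l%:E <= clarke_dd h x d)%E.
Proof.
move=> [dphi <-] hx hphi; apply/lee_addgt0Pr => e e0.
rewrite -leeBlDr// -EFinB; apply: clarke_dd_ge.
have l0 : (fun t : R => t^-1 *: ((phi \o shift x) (t *: d) - phi x)) @ 0^' -->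
  'D_d phi x by exact: dphi.
have line : (fun t : R => x + t *: d) @ (0 : R)^'+ --> x.
  rewrite -[X in _ --> X]addr0 -(scale0r d).
  have id0 : (fun t : R => t) @ (0 : R)^'+ --> (0 : R) by exact: cvg_within.
  exact: (cvgD (cvg_cst x) (cvgZ id0 (cvg_cst d))).
near=> t.
have t0 : 0 < t by near: t; exact: nbhs_right_gt.
have h1 : phi (x + t *: d) <= h (x + t *: d) by near: t; exact: (line _ hphi).
have h2 : 'D_d phi x - e < t^-1 * (phi (t *: d + x) - phi x).
  near: t; move/cvg_dnbhs_at_right/cvgrPdist_lt : l0 => /(_ _ e0).
  by apply: filterS => t; rewrite ltr_distlC => /andP[].
rewrite hx mulrC; apply: (le_trans (ltW h2)).
by rewrite ler_pM2l ?invr_gt0// lerD2r addrC.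
Unshelve. all: by end_near. Qed.

End clarke_lower_bound.

(** Along the segment from [y] to [z], subtract the linear model from [f] and add the quadratic
    term. The Lipschitz bound makes the derivative of the resulting [psi] nonnegative, and the mean
    value theorem gives [psi 0 <= psi 1]. *)
Lemma descent_y {R : realType} {n m : nat} (f : 'rV[R]_(n + m) -> R)
    (U : set 'rV[R]_(n + m)) (Y : set 'rV[R]_m) (L : R) (x : 'rV[R]_n)
    (y z : 'rV[R]_m) :
  (forall p, U p -> differentiable f p) ->
  (forall y', Y y' -> U (row_mx x y')) ->
  convex_set (Y : set (convex_lmodType 'rV[R]_m)) ->
  (forall y1 y2, Y y1 -> Y y2 ->
    enorm (grad f (row_mx x y1) - grad f (row_mx x y2)) <=
    L * enorm (row_mx x y1 - row_mx x y2)) ->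
  Y y -> Y z ->
  f (row_mx x y) + dotv (grad_y f x y) (z - y) <=
  f (row_mx x z) + L / 2 * enorm (z - y) ^+ 2.
Proof.
move=> df xU Yv lipL Yy Yz.
pose w := z - y; pose v : 'rV[R]_(n + m) := row_mx 0 w.
pose c := dotv (grad_y f x y) w.
pose a := L * enorm w ^+ 2.
have line s : row_mx x y + s *: v = row_mx x (y + s *: w).
  by rewrite -row_mx_line scaler0 addr0.
have Yline s : 0 <= s <= 1 -> Y (y + s *: w).
  move=> /andP[s0 s1].
  have := Yv z y (Itv01 s0 s1); rewrite !inE => /(_ Yz Yy).
  congr Y; rewrite /w; apply/rowP => i; rewrite !mxE /= /unstable.onem; ring.
pose psi (s : R) := f (row_mx x y + s *: v) - c * s + a / 2 * s ^+ 2.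
pose dpsi (s : R) := dotv (grad f (row_mx x y + s *: v)) v - c + a * s.
have dP (s : R) : 0 <= s <= 1 -> is_derive s 1 psi (dpsi s).
  move=> s01; have Us : U (row_mx x y + s *: v) by rewrite line; exact/xU/Yline.
  have d1 : is_derive s 1 (fun r => f (row_mx x y + r *: v))
      (dotv (grad f (row_mx x y + s *: v)) v).
    by apply: is_derive_line; exact/is_derive_grad/df.
  have d2 : is_derive s 1 (fun r : R => c * r) c.
    by apply: is_derive_eq; rewrite [_ *: _]mulr1.
  have d3 : is_derive s 1 (fun r : R => a / 2 * r ^+ 2) (a * s).
    apply: is_derive_eq; rewrite -![_ *: _]/(_ * _).
    by field.
  by apply: is_deriveD.
have [s s01 E] : exists2 s, s \in `]0, 1[%R & psi 1 - psi 0 = dpsi s * (1 - 0).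
  apply: MVT => //.
    by move=> r; rewrite in_itv/= => /andP[r0 r1]; apply: dP; rewrite !ltW.
  apply: continuous_in_subspaceT => r; rewrite inE/= in_itv/= => r01.
  by apply/differentiable_continuous/derivable1_diffP; have [] := dP r r01.
have {s01} /andP[s0 s1] : 0 < s < 1 by rewrite in_itv/= in s01.
have Ys : Y (y + s *: w) by apply: Yline; rewrite !ltW.
have dpsi_ge0 : 0 <= dpsi s.
  rewrite /dpsi line {1}/v dotv_row0mx.
  have : dotv (grad f (row_mx x y) - grad f (row_mx x (y + s *: w))) v <= a * s.
    apply: (le_trans (dotv_le_enorm _ _)); rewrite enorm_row0mx.
    rewrite (_ : a * s = L * (s * enorm w) * enorm w); last by rewrite /a; ring.
    rewrite ler_wpM2r ?enorm_ge0//; apply: (le_trans (lipL _ _ Yy Ys)).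
    rewrite -line opprD addrA subrr add0r -scaleNr enormZ normrN.
    by rewrite (ger0_norm (ltW s0)) enorm_row0mx.
  rewrite dotvDl dotvNl !dotv_row0mx -/(grad_y f x y) -/c.
  by move=> h; lra.
have line1 : row_mx x y + 1 *: v = row_mx x z.
  by rewrite line scale1r /w addrC subrK.
rewrite -/w -/c (_ : L / 2 * _ = a / 2); last by rewrite /a; ring.
move: E; rewrite /psi line1 scale0r addr0 expr1n expr0n/= => E.
lra.
Qed.

Lemma has_ubound_initial {R : realType} (g : nat -> R) (N : nat) :
  has_ubound [set g j | j in [set j | (j < N)%N]].
Proof.
exists (\sum_(i < N) `|g i|) => _ [j /= jN <-].
rewrite (bigD1 (Ordinal jN))//= (le_trans (ler_norm _))// lerDl.
exact: sumr_ge0.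
Qed.

Lemma has_ubound_compact {R : realType} {T : topologicalType} (K : set T)
    (g : T -> R) :
  K !=set0 -> compact K -> (forall y, K y -> {for y, continuous g}) ->
  has_ubound [set g y | y in K].
Proof.
move=> K0 cK cg; have [|c _ hc] := @compact_EVT_max T R g K K0 cK.
  by apply: continuous_in_subspaceT => y; rewrite inE => /cg.
by exists (g c) => _ [y Ky <-]; apply: hc; rewrite inE.
Qed.

(** * Danskin's lower bound for the value function *)

Section row_mx_pairs.
Context {R : realType} {n m : nat}.

Lemma cvg_row_mx_pair (x : 'rV[R]_n) (y : 'rV[R]_m) :
  (fun p : 'rV[R]_n * 'rV[R]_m => row_mx p.1 p.2) @ (x, y) --> row_mx x y.
Proof. by apply: cvg_row_mx; [exact: cvg_fst|exact: cvg_snd]. Qed.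

Lemma cvg_slice (g : 'rV[R]_(n + m) -> R) (x : 'rV[R]_n) (y : 'rV[R]_m) :
  {for row_mx x y, continuous g} ->
  (fun y' => g (row_mx x y')) @ y --> g (row_mx x y).
Proof.
move=> cg; have l : (fun y' : 'rV[R]_m => row_mx x y') @ y --> row_mx x y.
  by apply: (@cvg_row_mx R _ (nbhs y) _ n m (fun=> x) id);
    [exact: cvg_cst|exact: cvg_id].
exact: (cvg_comp _ _ l cg).
Qed.

(** The tube lemma around the compact slice over [x]. *)
Lemma near_row_mx_compact (U : set 'rV[R]_(n + m)) (Y : set 'rV[R]_m)
    (x : 'rV[R]_n) :
  open U -> compact Y -> (forall y, Y y -> U (row_mx x y)) ->
  \forall z \near x, forall y, Y y -> U (row_mx z y).
Proof.
move=> oU /compact_near_coveringP cY xU.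
apply: (cY _ (nbhs x) (fun z y => U (row_mx z y))) => y Yy.
have UUy : nbhs (row_mx x y) U by apply: open_nbhs_nbhs; split => //; exact: xU.
have [[A B] /= [nA nB] AB] := cvg_row_mx_pair UUy.
by exists (B, A) => // -[b a] /= [Bb Aa]; exact: (AB (a, b)).
Qed.

End row_mx_pairs.

(** With the maximizer [y] frozen, [f] is a smooth minorant of [Vmax f Y] near [x] that touches it
    at [x]. *)
Lemma clarke_dd_Vmax_ge {R : realType} {n m : nat} (f : 'rV[R]_(n + m) -> R)
    (U : set 'rV[R]_(n + m)) (Y : set 'rV[R]_m) (x d : 'rV[R]_n)
    (y : 'rV[R]_m) :
  open U -> compact Y -> (forall p, U p -> differentiable f p) ->
  (forall y', Y y' -> U (row_mx x y')) -> Y y ->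
  (forall y', Y y' -> f (row_mx x y') <= f (row_mx x y)) ->
  ((dotv (grad f (row_mx x y)) (row_mx d 0))%:E <= clarke_dd (Vmax f Y) x d)%E.
Proof.
move=> oU cY df xU Yy ymax.
have Y0 : Y !=set0 by exists y.
apply: (@clarke_dd_ge_derive _ _ _ (fun x' => f (row_mx x' y))).
- by apply: is_derive_row_mxl; exact/is_derive_grad/df/xU.
- apply/eqP; rewrite eq_le; apply/andP; split.
    apply: ge_sup; first by exists (f (row_mx x y)), y.
    by move=> _ [y' Yy' <-]; exact: ymax.
  apply: ub_le_sup; last by exists y.
  by exists (f (row_mx x y)) => _ [y' Yy' <-]; exact: ymax.
(* The supremum is an upper bound only if the set of values is bounded. For [z] near [x] this holds
   because the slice over [z] stays in [U], where [f] is continuous. *)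
- have := near_row_mx_compact oU cY xU; apply: filterS => z zU.
  apply: ub_le_sup; last by exists y.
  apply: has_ubound_compact => // y' Yy'.
  exact: (cvg_slice (differentiable_continuous (df _ (zU _ Yy')))).
Qed.

(** * Limits of the sampled problems *)

Section samples.
Context {R : realType} {n m : nat}.
Variables (X : set 'rV[R]_n) (Y : set 'rV[R]_m).
Variables (f : 'rV[R]_(n + m) -> R) (U : set 'rV[R]_(n + m)).
Hypotheses (oU : open U) (XYU : forall x y, X x -> Y y -> U (row_mx x y)).
Hypotheses (cY : compact Y) (C2f : C2_on U f).
Variables (ys : nat -> 'rV[R]_m).
Hypothesis Yys : forall j, Y (ys j).
Hypothesis dense_ys : forall y W, Y y -> nbhs y W -> exists j, W (ys j).

Let df p : U p -> differentiable f p. Proof. by case/C2f. Qed.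
Let dgf p : U p -> differentiable (grad f) p. Proof. by case/C2f. Qed.

Let Y0 : Y !=set0. Proof. by exists (ys 0%N). Qed.

Lemma cvg_f_pair x y : U (row_mx x y) ->
  (fun p : 'rV[R]_n * 'rV[R]_m => f (row_mx p.1 p.2)) @ (x, y) -->
  f (row_mx x y).
Proof.
move=> Uxy; have fc := differentiable_continuous (df Uxy).
exact: (cvg_comp _ _ (@cvg_row_mx_pair R n m x y) fc).
Qed.

Lemma cvg_grad_pair x y : U (row_mx x y) ->
  (fun p : 'rV[R]_n * 'rV[R]_m => grad f (row_mx p.1 p.2)) @ (x, y) -->
  grad f (row_mx x y).
Proof.
move=> Uxy; have fc := differentiable_continuous (dgf Uxy).
exact: (cvg_comp _ _ (@cvg_row_mx_pair R n m x y) fc).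
Qed.

Lemma cvg_hess_pair x y : U (row_mx x y) ->
  (fun p : 'rV[R]_n * 'rV[R]_m => hessian f (row_mx p.1 p.2)) @ (x, y) -->
  hessian f (row_mx x y).
Proof.
move=> Uxy; have [_ _ fc] := C2f Uxy.
exact: (cvg_comp _ _ (@cvg_row_mx_pair R n m x y) fc).
Qed.

Lemma is_derive_f x d y : U (row_mx x y) ->
  is_derive x d (fun x' => f (row_mx x' y))
    (dotv (grad f (row_mx x y)) (row_mx d 0)).
Proof.
by move=> Uxy; apply: is_derive_row_mxl; exact/is_derive_grad/df.
Qed.

(** If the bound failed at [y], it would fail on a neighborhood of [y] and hence at a sample. *)
Lemma le_of_dense x c : (forall y, Y y -> U (row_mx x y)) ->
  (forall j, f (row_mx x (ys j)) <= c) -> forall y, Y y -> f (row_mx x y) <= c.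
Proof.
move=> xU le_ys y Yy; rewrite leNgt; apply/negP => lt_y.
have fc : (fun y => f (row_mx x y)) @ y --> f (row_mx x y).
  exact: (cvg_slice (differentiable_continuous (df (xU _ Yy)))).
have [j] : exists j, c < f (row_mx x (ys j)).
  apply: (@dense_ys y [set y' | c < f (row_mx x y')]) => //.
  exact: (cvgr_gt _ fc).
by rewrite ltNge le_ys.
Qed.

Lemma near_pair_U x y : U (row_mx x y) ->
  \forall p \near (x, y), U (row_mx p.1 p.2).
Proof.
move=> Uxy; apply: (@cvg_row_mx_pair R n m x y U).
by apply: open_nbhs_nbhs.
Qed.

(** This is [qfun] before the inner maximization, with [w] the pair [(y, z)]. Thus [Vq] is a
    supremum, over samples [y] and all [z] in [Y], of functions that are differentiable in [x]. *)
Definition penalized (Lhat : R) (x : 'rV[R]_n) (w : 'rV[R]_m * 'rV[R]_m) : R :=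
  f (row_mx x w.1) +
  (dotv (grad_y f x w.1) (w.2 - w.1) - Lhat / 2 * enorm (w.2 - w.1) ^+ 2).

(** The vector paired with [w.2 - w.1] is [d *m hess_xy f x w.1]; the quadratic term is constant in
    [x]. *)
Definition dpenalized (d x : 'rV[R]_n) (w : 'rV[R]_m * 'rV[R]_m) : R :=
  dotv (grad f (row_mx x w.1)) (row_mx d 0) +
  dotv (rsubmx (row_mx d 0 *m hessian f (row_mx x w.1))) (w.2 - w.1).

Lemma is_derive_penalized Lhat d x w : U (row_mx x w.1) ->
  is_derive x d (fun x' => penalized Lhat x' w) (dpenalized d x w).
Proof.
move=> Uxw.
have d1 := is_derive_f d Uxw.
have d2 : is_derive x d
    (fun x' => dotv (rsubmx (grad f (row_mx x' w.1))) (w.2 - w.1))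
    (dotv (rsubmx (row_mx d 0 *m hessian f (row_mx x w.1))) (w.2 - w.1)).
  by apply: (is_derive_row_mxl (is_derive_grad_y _ _ _)); exact: dgf.
have d3 := is_derive_cst (Lhat / 2 * enorm (w.2 - w.1) ^+ 2) x d.
have d4 := is_deriveD d1 (is_deriveB d2 d3).
by rewrite subr0 in d4.
Qed.

Lemma cvg_fst_snd1 (x : 'rV[R]_n) (w : 'rV[R]_m * 'rV[R]_m) :
  (fun p : 'rV[R]_n * ('rV[R]_m * 'rV[R]_m) => (p.1, p.2.1)) @ (x, w) -->
  (x, w.1).
Proof.
have p2 : (fun p : 'rV[R]_n * ('rV[R]_m * 'rV[R]_m) => p.2) @ (x, w) --> w.
  exact: cvg_snd.
have p21 : (fun p : 'rV[R]_n * ('rV[R]_m * 'rV[R]_m) => p.2.1) @ (x, w) --> w.1.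
  by apply: (cvg_comp _ _ p2); exact: cvg_fst.
have p1 : (fun p : 'rV[R]_n * ('rV[R]_m * 'rV[R]_m) => p.1) @ (x, w) --> x.
  exact: cvg_fst.
exact: (cvg_pair p1 p21).
Qed.

Lemma cvg_snd_sub (x : 'rV[R]_n) (w : 'rV[R]_m * 'rV[R]_m) :
  (fun p : 'rV[R]_n * ('rV[R]_m * 'rV[R]_m) => p.2.2 - p.2.1) @ (x, w) -->
  w.2 - w.1.
Proof.
have p2 : (fun p : 'rV[R]_n * ('rV[R]_m * 'rV[R]_m) => p.2) @ (x, w) --> w.
  exact: cvg_snd.
have p21 : (fun p : 'rV[R]_n * ('rV[R]_m * 'rV[R]_m) => p.2.1) @ (x, w) --> w.1.
  by apply: (cvg_comp _ _ p2); exact: cvg_fst.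
have p22 : (fun p : 'rV[R]_n * ('rV[R]_m * 'rV[R]_m) => p.2.2) @ (x, w) --> w.2.
  by apply: (cvg_comp _ _ p2); exact: cvg_snd.
exact: (cvgB p22 p21).
Qed.

Lemma cvg_penalized Lhat x w : U (row_mx x w.1) ->
  (fun p : 'rV[R]_n * ('rV[R]_m * 'rV[R]_m) => penalized Lhat p.1 p.2) @
    (x, w) --> penalized Lhat x w.
Proof.
move=> Uxw.
have c1 := cvg_comp _ _ (@cvg_fst_snd1 x w) (cvg_f_pair Uxw).
have c2 := cvg_comp _ _ (@cvg_fst_snd1 x w) (cvg_grad_pair Uxw).
have c3 := @cvg_snd_sub x w.
by apply: (cvgD c1); apply: cvg_quadratic_model => //; exact: cvg_rsubmx.
Qed.

Lemma cvg_dpenalized d x w : U (row_mx x w.1) ->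
  (fun p : 'rV[R]_n * ('rV[R]_m * 'rV[R]_m) => dpenalized d p.1 p.2) @
    (x, w) --> dpenalized d x w.
Proof.
move=> Uxw.
have c2 := cvg_comp _ _ (@cvg_fst_snd1 x w) (cvg_grad_pair Uxw).
have c3 := cvg_comp _ _ (@cvg_fst_snd1 x w) (cvg_hess_pair Uxw).
apply: cvgD; first by apply: cvg_dotv => //; exact: cvg_cst.
apply: cvg_dotv; last exact: cvg_snd_sub.
by apply: cvg_rsubmx; apply: cvg_mulmx => //; exact: cvg_cst.
Qed.

Lemma has_ubound_penalty Lhat x y :
  has_ubound [set dotv (grad_y f x y) (z - y) - Lhat / 2 * enorm (z - y) ^+ 2
             | z in Y].
Proof.
apply: has_ubound_compact => // z _.
apply: (@cvg_quadratic_model R _ (nbhs z) _ m (Lhat / 2) (fun=> grad_y f x y)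
  (fun z' => z' - y)); first exact: cvg_cst.
by apply: (@cvgB _ _ _ (nbhs z) _ id (fun=> y)); [exact: cvg_id|exact: cvg_cst].
Qed.

Section limits.
Variables (F : set_system nat) (x_ : nat -> 'rV[R]_n) (x : 'rV[R]_n).
Hypotheses (FU : UltraFilter F) (FN : \oo `<=` F).
Hypotheses (x_x : x_ @ F --> x) (Xx : X x).

Let FF : Filter F. Proof. by apply: @filter_filter; exact: ultra_proper. Qed.

Lemma Vbar_clarke_limit (d : 'rV[R]_n) (g : nat -> R) :
  (forall N, (0 < N)%N -> ((g N)%:E <= clarke_dd (Vbar f ys N) (x_ N) d)%E) ->
  exists2 b, (b%:E <= clarke_dd (Vmax f Y) x d)%E &
    forall e : R, 0 < e -> F [set N | g N <= b + e].
Proof.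
move=> hg.
pose S N := ys @` [set j | (j < N)%N].
have xU y : Y y -> U (row_mx x y) by exact: XYU.
have [||||| |//|//|y [Yy ymax yb]] := @clarke_dd_sup_limit R n _ Y
    (fun x y => f (row_mx x y))
    (fun x y => dotv (grad f (row_mx x y)) (row_mx d 0))
    x d F S (Vbar f ys) x_ g FU FN cY.
- by move=> y Yy; exact/cvg_f_pair/xU.
- move=> y Yy; apply: cvg_dotv; [exact/cvg_grad_pair/xU|exact: cvg_cst].
- move=> y Yy; have := near_pair_U (xU _ Yy); apply: filterS => p.
  exact: is_derive_f.
- by move=> N _ _ [j _ <-].
- move=> N z _ _ [j jN <-]; apply: ub_le_sup; first exact: has_ubound_initial.
  by exists j.
- move=> N z e N0 e0.
  have [|_ [j jN <-] lt_e] := @sup_adherent R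
      [set f (row_mx z (ys j)) | j in [set j | (j < N)%N]] e e0.
    by split; [exists (f (row_mx z (ys 0%N))), 0%N|exact: has_ubound_initial].
  by exists (ys j) => //; exists j.
exists (dotv (grad f (row_mx x y)) (row_mx d 0)); last exact: yb.
apply: (@clarke_dd_Vmax_ge R n m f U Y x d y oU cY df xU Yy).
(* Sample [j] belongs to [S N] for every [N] from [j.+1] on, so the limit parameter beats each
   sample and, by density, all of [Y]. *)
apply: le_of_dense => // j.
apply: ymax => //; apply: FN; exists j.+1 => // N /= jN.
by exists j.
Qed.

Lemma Vq_clarke_limit (L Lhat : R) (d : 'rV[R]_n) (g : nat -> R) :
  L < Lhat ->
  (forall y z, Y y -> Y z -> f (row_mx x y) + dotv (grad_y f x y) (z - y) <=
     f (row_mx x z) + L / 2 * enorm (z - y) ^+ 2) ->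
  (forall N, (0 < N)%N ->
     ((g N)%:E <= clarke_dd (Vq f Y Lhat ys N) (x_ N) d)%E) ->
  exists2 b, (b%:E <= clarke_dd (Vmax f Y) x d)%E &
    forall e : R, 0 < e -> F [set N | g N <= b + e].
Proof.
move=> LLhat desc hg.
pose S N := (ys @` [set j | (j < N)%N]) `*` Y.
have xU y : Y y -> U (row_mx x y) by exact: XYU.
have [||||| |//|//|[y z] [[/= Yy Yz] wmax yb]] :=
    @clarke_dd_sup_limit R n _ (Y `*` Y) (penalized Lhat) (dpenalized d) x d F S
    (Vq f Y Lhat ys) x_ g FU FN (compact_setX cY cY).
- by move=> w [Yw _]; exact/cvg_penalized/xU.
- by move=> w [Yw _]; exact/cvg_dpenalized/xU.
- move=> w [Yw _].
  have : \forall p \near (x, w), U (row_mx p.1 p.2.1).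
    exact: (@cvg_fst_snd1 x w _ (near_pair_U (xU _ Yw))).
  by apply: filterS => p; exact: is_derive_penalized.
- by move=> N _ w [[j _ wj] Yw]; split => //; rewrite -wj.
- move=> N z w _ [[j jN wj] Yw].
  apply: (@le_trans _ _ (qfun f Y Lhat z w.1)).
    rewrite lerD2l; apply: ub_le_sup; first exact: has_ubound_penalty.
    by exists w.2.
  by apply: ub_le_sup; [exact: has_ubound_initial|exists j; rewrite ?wj].
(* Half of [e] is spent on the maximum over samples, half on the inner maximum over [Y]. *)
- move=> N z e N0 e0; have e20 : 0 < e / 2 by rewrite divr_gt0.
  have [|_ [j jN <-] lt_e] := @sup_adherent R
      [set qfun f Y Lhat z (ys j) | j in [set j | (j < N)%N]] _ e20.
    split; last exact: has_ubound_initial.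
    by exists (qfun f Y Lhat z (ys 0%N)), 0%N.
  have [|_ [z' Yz' <-] lt_e'] := @sup_adherent R
      [set dotv (grad_y f z (ys j)) (z' - ys j) -
           Lhat / 2 * enorm (z' - ys j) ^+ 2 | z' in Y] _ e20.
    split; last exact: has_ubound_penalty.
    by case: Y0 => z' Yz'; eexists; exists z'; first exact: Yz'.
  exists (ys j, z'); first by split => //; exists j.
  move: lt_e lt_e'; rewrite /Vq /qfun /penalized /=.
  set a := sup _; set b := sup _; lra.
(* Compare with the diagonal pair [(ys j, ys j)], at which [penalized] reduces to [f]. *)
have yz_ge j : f (row_mx x (ys j)) <= penalized Lhat x (y, z).
  have := wmax (ys j, ys j); rewrite /penalized/= subrr dotv0 enorm0 expr0n/=.
  rewrite mulr0 subr0 addr0; apply; first by split.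
  apply: FN; exists j.+1 => // N /= jN.
  by split; [exists j|exact: Yys].
have desc_yz := desc y z Yy Yz.
have yz_le : penalized Lhat x (y, z) <=
    f (row_mx x z) - (Lhat - L) / 2 * enorm (z - y) ^+ 2.
  by rewrite /penalized/=; lra.
have sq_ge0 : 0 <= (Lhat - L) / 2 * enorm (z - y) ^+ 2.
  by rewrite mulr_ge0 ?sqr_ge0// divr_ge0// subr_ge0 ltW.
have ge_all y' : Y y' -> f (row_mx x y') <= penalized Lhat x (y, z).
  by move=> Yy'; exact: (le_of_dense xU yz_ge Yy').
(* At [y' = z] the two bounds on [penalized Lhat x (y, z)] leave no room for a positive multiple of
   the squared distance from [y] to [z]. *)
have yz : z = y.
  apply/eqP; rewrite -subr_eq0; apply/eqP/enorm_eq0/eqP.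
  rewrite -sqrf_eq0 eq_le sqr_ge0 andbT.
  have := ge_all z Yz; rewrite -(@pmulr_rle0 _ ((Lhat - L) / 2)); first by lra.
  by rewrite divr_gt0// subr_gt0.
have zmax y' : Y y' -> f (row_mx x y') <= f (row_mx x z).
  by move=> Yy'; have := ge_all y' Yy'; lra.
exists (dpenalized d x (y, z)); last exact: yb.
rewrite /dpenalized/= yz subrr dotv0 addr0 -yz.
exact: (@clarke_dd_Vmax_ge R n m f U Y x d z oU cY df xU Yz).
Qed.

End limits.
End samples.

(** * Density of the samples *)

Lemma compact_finite_net {R : realType} {V : normedModType R} (Y : set V)
    (e : R) :
  compact Y -> 0 < e -> exists D : seq V,
    (forall c, c \in D -> Y c) /\
    forall y, Y y -> exists2 c, c \in D & ball c e y.
Proof.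
move=> + e0; rewrite compact_cover => cY.
have [||D DY Ycov] := cY V Y (fun c => (ball c e)^°).
- by move=> c _; exact: open_interior.
- by move=> y Yy; exists y => //; exact: nbhsx_ballx.
exists (enum_fset D); split=> [c cD|y Yy].
  by have := DY c cD; rewrite inE.
by have [c cD /interior_subset cy] := Ycov y Yy; exists c.
Qed.

Lemma measurable_closed_rV {R : realType} {m : nat} (A : set 'rV[R]_m) :
  closed A -> measurable (A : set (rVborel R m)).
Proof.
move=> cA; rewrite -(setCK (A : set (rVborel R m))); apply: measurableC.
by apply: sub_sigma_algebra; exact: closed_openC.
Qed.

Section iid.
Context {R : realType} {d d' : measure_display}.
Context {Omega : measurableType d} {T : measurableType d'}.
Variables (Pr : probability Omega R) (P : probability T R).
Variable y : nat -> {RV Pr >-> T}.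
Hypothesis hy : iid_samples P y.

Lemma preimage_sample (A : set T) j : measurable A -> Pr (y j @^-1` A) = P A.
Proof. by move=> mA; case: hy => _ /(_ j A mA). Qed.

Lemma measurable_preimage_sample (A : set T) j :
  measurable A -> measurable (y j @^-1` A).
Proof.
by move=> mA; rewrite -[X in measurable X]setTI; exact: measurable_funP.
Qed.

Lemma ae_samples_in (A : set T) : measurable A -> P A = 1%E ->
  \forall w \ae Pr, forall j, A (y j w).
Proof.
move=> mA PA; apply: ae_foralln => j; exists (y j @^-1` (~` A)); split => //.
  by apply: measurable_preimage_sample; exact: measurableC.
apply: (etrans (preimage_sample j (measurableC mA))).
by rewrite probability_setC// PA subee.
Qed.

Lemma ae_sample_hits (A : set T) : measurable A -> (0 < P A)%E ->
  \forall w \ae Pr, exists j, A (y j w).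
Proof.
move=> mA PA; have mAC := measurableC mA.
pose B := \bigcap_j (y j @^-1` (~` A)).
have mB : measurable B.
  by apply: bigcap_measurable => // j _; exact: measurable_preimage_sample.
exists B; split => //; last first.
  by move=> w /= nA j _ /= Aj; apply: nA; exists j.
pose r := fine (P (~` A)).
have rE : P (~` A) = r%:E by rewrite fineK// fin_num_measure.
have r0 : 0 <= r by rewrite fine_ge0.
have r1 : r < 1.
  have pE : P A = (fine (P A))%:E by rewrite fineK// fin_num_measure.
  rewrite -lte_fin -rE probability_setC// pE -EFinB lte_fin ltrBlDr ltrDl.
  by rewrite -lte_fin -pE.
(* [B] lies in the event that the samples with index below [M] all miss [A]; by independence that
   event has probability [r ^+ M]. *)
have le_r M : (Pr B <= (r ^+ M)%:E)%E.
  pose J := seq_fset tt (iota 0 M).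
  have -> : (r ^+ M)%:E = (\prod_(j <- J) Pr (y j @^-1` (~` A)))%E.
    under eq_bigr do rewrite preimage_sample// rE.
    rewrite (_ : M = size J); last first.
      by rewrite size_seq_fset undup_id ?iota_uniq ?size_iota.
    elim: (enum_fset J) => [|i s IH]; first by rewrite big_nil expr0.
    by rewrite big_cons -IH /= exprS EFinM.
  case: hy => <-// _; apply: le_measure; rewrite ?inE//; last first.
    by move=> w Bw j _; exact: Bw.
  apply: fin_bigcap_measurable => [|j _]; first exact: finite_fset.
  exact: measurable_preimage_sample.
apply/eqP; rewrite eq_le measure_ge0 andbT.
have PrB : Pr B = (fine (Pr B))%:E by rewrite fineK// fin_num_measure.
rewrite PrB lee_fin.
have cr : (fun M => r ^+ M) @ \oo --> 0 by apply: cvg_expr; rewrite ger0_norm.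
apply: (cvgr_to_ge cr); near=> M.
by rewrite -lee_fin -PrB.
Unshelve. all: by end_near. Qed.

End iid.

Lemma ae_samples_dense {R : realType} {m : nat} (Y : set 'rV[R]_m)
    (P : probability (rVborel R m) R) (delta0 : R)
    (d : measure_display) (Omega : measurableType d) (Pr : probability Omega R)
    (y : nat -> {RV Pr >-> rVborel R m}) :
  Y !=set0 -> compact Y -> 0 < delta0 ->
  (forall c delta, Y c -> 0 < delta -> delta < delta0 ->
    (0 < P [set z : 'rV[R]_m | Y z /\ (enorm (z - c) <= delta)%R])%E) ->
  iid_samples P y ->
  \forall w \ae Pr, forall (c : 'rV[R]_m) (W : set 'rV[R]_m),
    Y c -> nbhs c W -> exists j, W (y j w).
Proof.
move=> [y0 Yy0] cY delta0_gt0 mass hy.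
pose e (k : nat) : R := k.+1%:R^-1.
have e0 k : 0 < e k by rewrite invr_gt0.
have [D DP] := choice (fun k => compact_finite_net cY (e0 k)).
(* Halving [delta0] gives the strict inequality that the mass condition demands. *)
pose delta k := Num.min (e k) (delta0 / 2).
have dl0 k : 0 < delta k by rewrite lt_min e0 divr_gt0.
have dlt k : delta k < delta0.
  by rewrite gt_min; apply/orP; right; lra.
(* The index [i] ranges over all naturals, so that countably many null sets suffice. Beyond the end
   of [D k] the center defaults to [y0], which also lies in [Y]. *)
have : \forall w \ae Pr, forall k i, exists j,
    enorm ((y j w : 'rV[R]_m) - nth y0 (D k) i) <= delta k.
  apply: ae_foralln => k; apply: ae_foralln => i.
  set c := nth y0 (D k) i.
  have Yc : Y c.
    have [ik|ki] := ltnP i (size (D k)); last by rewrite /c nth_default.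
    by have [+ _] := DP k; apply; exact: mem_nth.
  have cl : closed [set z : 'rV[R]_m | Y z /\ enorm (z - c) <= delta k].
    apply: closedI; first exact: compact_closed.
    apply: (closed_comp _ (@closed_le R (delta k))) => z _.
    apply: (@cvg_enorm R _ (nbhs z) _ m (fun z' => z' - c)).
    apply: (@cvgB _ _ _ (nbhs z) _ id (fun=> c)).
      exact: cvg_id.
    exact: cvg_cst.
  have mk := mass c _ Yc (dl0 k) (dlt k).
  have := ae_sample_hits hy (measurable_closed_rV cl) mk.
  by apply: filterS => w [j [_ jw]]; exists j.
apply: filterS => w hw c W Yc /nbhs_ballP[r /= r0 rW].
(* Two steps of length at most [e k] lead from [c] to a center of the net and on to a sample. *)
have [k kr] : exists k, e k < r / 2.
  have : (fun k => e k) @ \oo --> 0 by exact: cvg_harmonic.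
  move=> /cvgrPdist_lt/(_ (r / 2)); rewrite divr_gt0//.
  move=> /(_ isT) /filter_ex[k].
  by rewrite sub0r normrN gtr0_norm// => ?; exists k.
have [_ /(_ c Yc)[c' c'D cc']] := DP k.
have [j hj] := hw k (index c' (D k)); rewrite nth_index// in hj.
exists j; apply: rW; rewrite -ball_normE/=.
rewrite (_ : c - _ = (c - c') + (c' - (y j w : 'rV[R]_m))); last first.
  by rewrite addrA subrK.
apply: (le_lt_trans (ler_normD _ _)).
have h1 : `|c - c'| < e k by rewrite distrC; move: cc'; rewrite -ball_normE.
have h2 : `|c' - (y j w : 'rV[R]_m)| <= e k.
  rewrite distrC (le_trans (norm_le_enorm _))// (le_trans hj)//.
  by rewrite ge_min lexx.
rewrite (splitr r); apply: ltrD; first exact: lt_trans kr.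
exact: le_lt_trans kr.
Qed.

(** * Almost sure stationarity of limit points *)

Theorem proposition1 (R : realType) (n m : nat)
    (X : set 'rV[R]_n) (Y : set 'rV[R]_m)
    (hX0 : X !=set0) (hXc : compact X)
    (hXv : convex_set (X : set (convex_lmodType 'rV[R]_n)))
    (hY0 : Y !=set0) (hYc : compact Y)
    (hYv : convex_set (Y : set (convex_lmodType 'rV[R]_m)))
    (f : 'rV[R]_(n + m) -> R) (U : set 'rV[R]_(n + m))
    (hU : open U) (hXYU : forall x y, X x -> Y y -> U (row_mx x y))
    (hf : C2_on U f)
    (L L0 Lhat : R) (hL : 0 < L) (hL0 : 0 < L0) (hLhat : L < Lhat)
    (hgradL : forall x y x' y', X x -> Y y -> X x' -> Y y' ->
      enorm (grad f (row_mx x y) - grad f (row_mx x' y')) <=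
      L * enorm (row_mx x y - row_mx x' y'))
    (hhessL : forall x y x' y', X x -> Y y -> X x' -> Y y' ->
      opnorm (hess_xy f x y - hess_xy f x' y') <=
      L0 * enorm (row_mx x y - row_mx x' y'))
    (hgradB : forall x y, X x -> Y y -> enorm (grad f (row_mx x y)) <= L)
    (P : probability (rVborel R m) R) (hPY : P Y = 1%E)
    (C0 gamma delta0 : R)
    (hC0 : 0 < C0) (hgamma : 0 < gamma) (hdelta0 : 0 < delta0)
    (hmass : forall (y0 : 'rV[R]_m) (delta : R), Y y0 -> 0 < delta -> delta < delta0 ->
      ((C0 * delta `^ gamma)%:E <=
       P [set y : 'rV[R]_m | Y y /\ (enorm (y - y0) <= delta)%R])%E)
    (d : measure_display) (Omega : measurableType d)
    (Pr : probability Omega R)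
    (y : nat -> {RV Pr >-> rVborel R m}) (hy : iid_samples P y) :
  \forall w \ae Pr,
    let ys : nat -> 'rV[R]_m := fun j => y j w in
    forall (x_ : nat -> 'rV[R]_n) (x : 'rV[R]_n),
      (forall N, (0 < N)%N -> X (x_ N)) ->
      x_ @ \oo --> x ->
      (forall N, (0 < N)%N -> stationary X (Vbar f ys N) (x_ N)) \/
      (forall N, (0 < N)%N -> stationary X (Vq f Y Lhat ys N) (x_ N)) ->
      stationary X (Vmax f Y) x.
Proof.
have YU x : X x -> forall y', Y y' -> U (row_mx x y').
  by move=> Xx y'; exact: hXYU.
have mY : measurable (Y : set (rVborel R m)).
  exact: (measurable_closed_rV (compact_closed (@norm_hausdorff _ _) hYc)).
have inY := ae_samples_in hy mY hPY.
have dense : \forall w \ae Pr, forall (c : 'rV[R]_m) (W : set 'rV[R]_m),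
    Y c -> nbhs c W -> exists j, W (y j w).
  apply: (@ae_samples_dense R m Y P delta0) => // c delta Yc dl0 dlt.
  apply: lt_le_trans (hmass c delta Yc dl0 dlt).
  by rewrite lte_fin mulr_gt0// powR_gt0.
(* The null set is fixed before the sequence [x_] is chosen; from here on the argument is
   deterministic. *)
apply: filterS2 inY dense => w Yys dense_ys x_ x Xx_ x_x st.
have Xx : X x.
  apply: (@closed_cvg _ _ \oo _ x_ X _ _ x) => //.
    exact: (compact_closed (@norm_hausdorff _ _) hXc).
  by exists 1%N => // N /= N0; exact: Xx_.
have df p : U p -> differentiable f p by case/hf.
(* [F] refines [\oo], so [x_] still converges along it. *)
have [F [FU FN]] := ultraFilterLemma (@eventually_filter).
have x_F : x_ @ F --> x by apply: cvg_trans x_x; exact: cvg_app.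
case: st => st; apply: (stationary_limit FU FN x_F st) => dd g hg.
  exact: (Vbar_clarke_limit hU hXYU hYc hf Yys dense_ys FU FN x_F Xx hg).
apply: (Vq_clarke_limit hU hXYU hYc hf Yys dense_ys FU FN x_F Xx hLhat _ hg).
(* The descent inequality is needed only at the limit point, which lies in [X], where the gradient
   is Lipschitz. *)
move=> y1 z1 Yy1 Yz1; apply: (descent_y df (YU x Xx) hYv _ Yy1 Yz1).
by move=> y2 y3 Yy2 Yy3; exact: hgradL.
Qed.
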